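(* Let $5\le K\le L$ be integers and consider the Blume--Capel Hamiltonian $H(\sigma)=\sum_{x\sim y}\{\sigma(x)-\sigma(y)\}^2$ on $\mathcal{X}=\{-1,0,+1\}^\Lambda$, where $\Lambda=\{1,\dots,K\}\times\{1,\dots,L\}$ is given either periodic or open boundary conditions. Define $$\Gamma=\begin{cases}2K+2 & \text{under periodic boundary conditions},\\ K+1 & \text{under open boundary conditions}.\end{cases}$$ For spins $a,b$ let $\Gamma_{a,b}=\Phi(\mathbf{a},\mathbf{b})$ be the communication height between the monochromatic configurations $\mathbf{a}$ and $\mathbf{b}$. Then $$\Gamma_{-1,0}=\Gamma_{0,+1}=\Gamma_{-1,+1}=\Gamma.$$
   Context: For $x,y\in\Lambda$, $x\sim y$ means that $x$ and $y$ are nearest neighbors, i.e. $|x-y|=1$ (in $\mathbb{Z}^2$ for open boundary conditions; in the discrete torus $\mathbb{T}_K\times\mathbb{T}_L$ for periodic boundary conditions). The sum in $H$ is over unordered nearest-neighbor pairs. For a spin $a\in\{-1,0,+1\}$, $\mathbf{a}\in\mathcal{X}$ is the configuration all of whose spins are $a$. For $\sigma\ne\zeta$ in $\mathcal{X}$ write $\sigma\sim\zeta$ if $\zeta$ is obtained from $\sigma$ by changing the spin at exactly one site to another value in $\{-1,0,+1\}$. A path is a sequence $(\omega_n)_{n=0}^N$ in $\mathcal{X}$ with $\omega_n\sim\omega_{n+1}$ for all $0\le n\le N-1$; it connects $\sigma$ and $\zeta$ if $\omega_0=\sigma$, $\omega_N=\zeta$ or vice versa. The communication height is $\Phi(\sigma,\zeta)=\min_{(\omega_n)}\max_{0\le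 n\le N}H(\omega_n)$, the minimum being over all paths connecting $\sigma$ and $\zeta$. *)

(* Defs.v *)
From HB Require Import structures.
From mathcomp Require Import all_boot all_order all_algebra.
From mathcomp Require Import boolp classical_sets.

Set Implicit Arguments.
Unset Strict Implicit.
Unset Printing Implicit Defensive.

Import Order.TTheory GRing.Theory Num.Theory.
Local Open Scope classical_set_scope.
Local Open Scope ring_scope.

Inductive spin := Minus | Zero | Plus.

Definition spin_val (a : spin) : int :=
  match a with Minus => -1 | Zero => 0 | Plus => 1 end.

Definition spin_code (a : spin) : option bool :=
  match a with Minus => Some false | Zero => None | Plus => Some true end.
Definition spin_decode (o : option bool) : spin :=
  match o with Some false => Minus | None => Zero | Some true => Plus end.
Lemma spin_codeK : cancel spin_code spin_decode.
Proof. by case. Qed.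
HB.instance Definition _ := Finite.copy spin (can_type spin_codeK).

Inductive boundary := PeriodicBC | OpenBC.

(* {1..K} x {1..L}, with both coordinates shifted by one *)
Definition site (K L : nat) := ('I_K * 'I_L)%type.

(* distance between two coordinates, in Z or in Z/nZ *)
Definition coord_dist (bc : boundary) (n : nat) (i j : 'I_n) : nat :=
  let d := `|(i%:Z - j%:Z)%R|%N in
  match bc with PeriodicBC => minn d (n - d) | OpenBC => d end.

(* Euclidean distance equal to 1 *)
Definition nearest (bc : boundary) (K L : nat) : rel (site K L) :=
  fun x y => (coord_dist bc x.1 y.1 ^ 2 + coord_dist bc x.2 y.2 ^ 2 == 1)%N.

Definition config (K L : nat) := {ffun site K L -> spin}.

Definition mono (K L : nat) (a : spin) : config K L := [ffun=> a].

(* The enum_rank condition keeps one ordering of each unordered pair. *)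
Definition H (bc : boundary) (K L : nat) (s : config K L) : int :=
  \sum_(p : site K L * site K L |
        nearest bc p.1 p.2 && (enum_rank p.1 < enum_rank p.2)%N)
    (spin_val (s p.1) - spin_val (s p.2)) ^+ 2.

Definition one_flip (K L : nat) : rel (config K L) :=
  fun s z => #|[set x | s x != z x]%SET| == 1%N.

(* The path (w_n)_{0 <= n <= N} is given as w_0 and w = [:: w_1; ...; w_N]. *)
Definition connects (K L : nat) (s z w0 : config K L) (w : seq (config K L)) :=
  path (@one_flip K L) w0 w /\
  ((w0 = s /\ last w0 w = z) \/ (w0 = z /\ last w0 w = s)).

Definition height (bc : boundary) (K L : nat) (w0 : config K L)
    (w : seq (config K L)) : int :=
  \big[Order.max/H bc w0]_(s <- w) H bc s.

Definition heights (bc : boundary) (K L : nat) (s z : config K L) : set int :=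
  [set h | exists w0 w, connects s z w0 w /\ h = height bc w0 w].

Definition is_minimum (A : set int) (m : int) : Prop :=
  A m /\ forall h, A h -> m <= h.

(* The default value 0 is never used: see Phi_minimum. *)
Definition Phi (bc : boundary) (K L : nat) (s z : config K L) : int :=
  xget 0 [set m | is_minimum (heights bc s z) m].

Definition comm_height (bc : boundary) (K L : nat) (a b : spin) : int :=
  Phi bc (mono K L a) (mono K L b).

Definition Gamma (bc : boundary) (K : nat) : int :=
  match bc with
  | PeriodicBC => 2 * K%:Z + 2
  | OpenBC => K%:Z + 1
  end.

Lemma H_ge0 bc K L (s : config K L) : 0 <= H bc s.
Proof. by apply: sumr_ge0 => p _; apply: sqr_ge0. Qed.

Lemma height_ge0 bc K L (w0 : config K L) w : 0 <= height bc w0 w.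
Proof.
rewrite /height; elim: w => [|s w IHw]; first by rewrite big_nil H_ge0.
by rewrite big_cons le_max IHw orbT.
Qed.

Lemma config_connected K L (s z : config K L) :
  exists2 w, path (@one_flip K L) s w & last s w = z.
Proof.
have [n] := ubnP #|[set x | s x != z x]%SET|.
elim: n s => // n IHn s; rewrite ltnS => len.
case: (pickP (fun x => s x != z x)) => [x sx|sz]; last first.
  by exists [::] => //=; apply/ffunP => x; apply/eqP/negbFE/sz.
pose t : config K L := [ffun y => if y == x then z y else s y].
have [|w pw lw] := IHn t.
  apply: leq_trans len; apply: proper_card; apply/properP; split.
    apply/fintype.subsetP => y; rewrite !inE ffunE.
    by case: (eqVneq y x) => // ->; rewrite eqxx.
  by exists x; rewrite !inE // ffunE !eqxx.
exists (t :: w) => //=; rewrite pw andbT /one_flip.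
rewrite (_ : [set y | _]%SET = [set x]%SET) ?cards1 //.
apply/setP => y; rewrite !inE ffunE.
by case: (eqVneq y x) => [->//|_]; rewrite eqxx.
Qed.

Lemma Phi_minimum bc K L (s z : config K L) :
  is_minimum (heights bc s z) (Phi bc s z).
Proof.
rewrite /Phi; case: xgetP => [m _ //|noM].
have [w pw lw] := config_connected s z.
have exn : exists n : nat, `[< heights bc s z n%:Z >].
  exists `|height bc s w|%N; apply/asboolP.
  rewrite gez0_abs ?height_ge0 //; exists s, w; do 2!split => //.
  by left.
case: (ex_minnP exn) => m /asboolP hm minm.
case: (noM m%:Z); split => // h hh.
have h0 : 0 <= h by case: hh => w0 [w' [_ ->]]; apply: height_ge0.
by rewrite -(gez0_abs h0) lez_nat minm //; apply/asboolP; rewrite gez0_abs.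
Qed.

(* Main.v *)
(** Let m be 1 (open) or 2 (periodic). The energy is the sum of the energies
    of the rows and columns, and a line meeting both [{s = a}] and its
    complement has energy at least m. If [Phi] were smaller than
    [Gamma = m (K + 1)], then along an optimal path from [a] to [b] at most K lines would
    be mixed at every step. A set A with at most K mixed lines has
    cardinality divisible by K, or else has an unmixed row and an unmixed
    column; these cross, so all unmixed lines are of the same kind and A or its
    complement lies in an r x c box with r + c <= K, hence has at most K^2/4
    sites. But the size of [{s = a}] changes by at most one per step, so it
    passes through K * (L / 2) + 1, which is excluded.
    Conversely, flipping the sites column after column, in steps of one between
    spins, keeps every row at energy at most m with at most one mixed column,
    and [Minus] to [Plus] is done through [Zero]. *)

Require Import Defs.
From mathcomp Require Import all_boot all_order all_algebra.
From mathcomp Require Import zify.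

Set Implicit Arguments.
Unset Strict Implicit.
Unset Printing Implicit Defensive.

Import Order.TTheory GRing.Theory Num.Theory.
Local Open Scope ring_scope.

(** * Splitting the energy into rows and columns *)

Definition succ_site (bc : boundary) (n : nat) (i j : 'I_n) : bool :=
  match bc with PeriodicBC => j == i.+1 %% n :> nat | OpenBC => j == i.+1 :> nat end%N.

Definition min_flips (bc : boundary) : nat :=
  match bc with PeriodicBC => 2 | OpenBC => 1 end.

(** Edges point from a coordinate to its successor, so for n > 2 each edge of the line is counted
    exactly once. *)
Definition line_energy (bc : boundary) (n : nat) (v : 'I_n -> int) : int :=
  \sum_(p : 'I_n * 'I_n | succ_site bc p.1 p.2) (v p.1 - v p.2) ^+ 2.

Lemma modnS_if (n i : nat) : (i < n)%N ->
  (i.+1 %% n = if i.+1 == n then 0 else i.+1)%N.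
Proof.
move=> lin; case: eqP => [->|ne]; first by rewrite modnn.
by rewrite modn_small // ltn_neqAle lin andbT; apply/eqP.
Qed.

Lemma coord_dist_eq0 bc n (i j : 'I_n) : (coord_dist bc i j == 0%N) = (i == j).
Proof.
have := ltn_ord i; have := ltn_ord j.
by rewrite -(inj_eq val_inj) /=; case: bc; rewrite /coord_dist /=; lia.
Qed.

Lemma coord_dist_eq1 bc n (i j : 'I_n) : (2 < n)%N ->
  (coord_dist bc i j == 1%N) = succ_site bc i j || succ_site bc j i.
Proof.
move=> n2; have := ltn_ord i; have := ltn_ord j.
case: bc; rewrite /coord_dist /succ_site /= => lj li; last by lia.
by rewrite !modnS_if //; do 2![case: ifP => ?]; lia.
Qed.

(** On a cycle of length two each site would be the successor of the other; this is why n > 2 is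
    assumed. *)
Lemma succ_site_asym bc n (i j : 'I_n) : (2 < n)%N ->
  succ_site bc i j -> ~~ succ_site bc j i.
Proof.
move=> n2; have := ltn_ord i; have := ltn_ord j.
case: bc; rewrite /succ_site => lj li; last by lia.
by rewrite !modnS_if //; do 2![case: ifP => ?]; lia.
Qed.

(** Both sums choose one orientation of each edge. Where the choices differ, swapping the pair
    matches them, and F is symmetric. This replaces the [enum_rank] ordering in [H] by the successor
    orientation. *)
Lemma sum_oriented (T : finType) (V : nmodType) (e d : rel T) (F : T -> T -> V) :
    (forall x y, F x y = F y x) -> (forall x y, e x y = d x y || d y x) ->
    (forall x y, d x y -> ~~ d y x) ->
  \sum_(p : T * T | e p.1 p.2 && (enum_rank p.1 < enum_rank p.2)%N) F p.1 p.2 =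
  \sum_(p : T * T | d p.1 p.2) F p.1 p.2.
Proof.
move=> Fsym ed dasym.
rewrite (bigID (fun p => d p.1 p.2)) /=.
rewrite [RHS](bigID (fun p : T * T => enum_rank p.1 < enum_rank p.2)%N) /=.
congr (_ + _).
  by apply: eq_bigl => -[x y] /=; rewrite ed; case: (d x y); rewrite ?andbT ?andbF.
rewrite [RHS](reindex_inj (h := fun p : T * T => (p.2, p.1))) /=; last first.
  by move=> [x y] [x' y'] /= [-> ->].
apply: eq_big => [[x y]|[x y] _] //=; rewrite ed -leqNgt.
have := @dasym x y.
case: (boolP (d x y)) => [dxy /(_ isT) /negbTE-> | _ _]; first by rewrite andbF.
case: (boolP (d y x)) => //= dyx; rewrite andbT ltn_neqAle.
case: eqP => //= /val_inj/enum_rank_inj xy.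
by subst; have := dasym _ _ dyx; rewrite dyx.
Qed.

Lemma energy_lines bc K L (s : config K L) : (2 < K)%N -> (2 < L)%N ->
  H bc s = \sum_i line_energy bc (fun j => spin_val (s (i, j))) +
           \sum_j line_energy bc (fun i => spin_val (s (i, j))).
Proof.
move=> K2 L2.
pose d : rel (site K L) := fun x y =>
  (x.1 == y.1) && succ_site bc x.2 y.2 || (x.2 == y.2) && succ_site bc x.1 y.1.
have noloop n (i : 'I_n) : (2 < n)%N -> succ_site bc i i = false.
  by move=> n2; apply/negP => ii; have := succ_site_asym n2 ii; rewrite ii.
rewrite /H (sum_oriented (F := fun x y => (spin_val (s x) - spin_val (s y)) ^+ 2)
   (d := d)); first last.
- move=> [i j] [i' j']; rewrite /d /=.
  case/orP => /andP[/eqP<- u]; rewrite eqxx noloop // andbF /= ?orbF.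
    exact: succ_site_asym.
  exact: succ_site_asym.
- move=> [i j] [i' j']; rewrite /d /nearest /=.
  rewrite (eq_sym i') (eq_sym j') -!(coord_dist_eq0 bc).
  transitivity ((coord_dist bc i i' == 0%N) && (coord_dist bc j j' == 1%N) ||
    (coord_dist bc j j' == 0%N) && (coord_dist bc i i' == 1%N)).
    by case: (coord_dist bc i i') => [|[|a]]; case: (coord_dist bc j j') => [|[|b]] //=; rewrite -!mulnn; nia.
  rewrite !coord_dist_eq1 //; do 2![case: (_ == 0%N)] => //=; rewrite ?orbF //.
  by rewrite orbACA.
- by move=> x y; rewrite -sqrrN opprB.
rewrite (bigID (fun p : site K L * site K L => p.1.1 == p.2.1)) /=; congr (_ + _).
- under [RHS]eq_bigr do rewrite /line_energy.
  rewrite pair_big_dep /=.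
  rewrite (reindex_onto (fun p : 'I_K * ('I_L * 'I_L) => ((p.1, p.2.1), (p.1, p.2.2)))
    (fun p => (p.1.1, (p.1.2, p.2.2)))) /=; last first.
    by move=> [[i j] [i' j']] /= /andP[_ /eqP->].
  by apply: eq_bigl => -[i [j j']]; rewrite /d /= !eqxx noloop //= andbF orbF !andbT.
- rewrite /line_energy pair_big_dep /=.
  rewrite (reindex_onto (fun p : 'I_L * ('I_K * 'I_K) => ((p.2.1, p.1), (p.2.2, p.1)))
    (fun p => (p.1.2, (p.1.1, p.2.1)))) /=; last first.
    by move=> [[i j] [i' j']] /= /andP[]; rewrite /d /= => /orP[/andP[->]//|/andP[/eqP-> _]].
  apply: eq_bigl => -[j [i i']]; rewrite /d /= !eqxx noloop //= andbF /= !andbT.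
  by case: eqP => [->|]; rewrite ?noloop // andbT.
Qed.

(** * Energy of a single line *)

Lemma cyclic_crossing n (P : pred 'I_n) (i j : 'I_n) : P i -> ~~ P j ->
  exists a b : 'I_n, [/\ succ_site PeriodicBC a b, P a & ~~ P b].
Proof.
move=> Pi nPj; have n0 : (0 < n)%N := leq_ltn_trans (leq0n i) (ltn_ord i).
case: (pickP (fun p : 'I_n * 'I_n =>
    [&& succ_site PeriodicBC p.1 p.2, P p.1 & ~~ P p.2])) => [[a b] /and3P[]|none].
  by exists a, b.
(* Without a crossing, P spreads from i around the whole cycle; it reaches j after n - i + j
   steps. *)
have Pk k : P (Ordinal (ltn_pmod (i + k) n0)).
  elim: k => [|k IHk].
    by congr (P _): Pi; apply: val_inj; rewrite /= addn0 modn_small.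
  have := none (Ordinal (ltn_pmod (i + k) n0), Ordinal (ltn_pmod (i + k.+1) n0)).
  by rewrite /= IHk -[(_ %% _)%N.+1]addn1 modnDml addn1 addnS eqxx /= => /negbFE.
case/negP: nPj; have := Pk (n - i + j)%N; congr (P _); apply: val_inj => /=.
by rewrite addnA subnKC 1?ltnW // modnDl modn_small.
Qed.

(** Around the cycle, the set where v is c is left along one edge and entered along another. Each of
    the two carries a nonzero integer square, and opening the line removes at most one of them. *)
Lemma line_energy_ge bc n (v : 'I_n -> int) (c : int) (i j : 'I_n) :
  v i = c -> v j != c -> (min_flips bc)%:Z <= line_energy bc v.
Proof.
move=> vi vj.
have [a [b [sab Pa Pb]]] := @cyclic_crossing n (fun k => v k == c) i j (introT eqP vi) vj.
have [|a' [b' [sab' Pa' Pb']]] :=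
  @cyclic_crossing n (fun k => v k != c) j i vj; first by rewrite negbK vi.
rewrite negbK in Pb'.
have term k l : (v k == c) != (v l == c) -> 1 <= (v k - v l) ^+ 2.
  move=> kl; have : v k != v l by apply: contraNneq kl => ->; rewrite eqxx.
  by rewrite -subr_eq0 => vkl; rewrite -gtz0_ge1 exprn_even_gt0.
have tab := term a b; have tab' := term a' b'.
rewrite Pa (negbTE Pb) in tab; rewrite (negbTE Pa') Pb' in tab'.
case: bc => /=; rewrite /line_energy.
  rewrite (bigD1 (a, b)) //= (bigD1 (a', b')) /=; last first.
    by rewrite [X in X && _]sab' xpair_eqE; apply: contraNN Pa' => /andP[/eqP->].
  have := tab isT; have := tab' isT; set S := (X in _ + (_ + X)).
  have : 0 <= S by apply: sumr_ge0 => p _; apply: sqr_ge0.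
  by lia.
have one k l : succ_site OpenBC k l -> 1 <= (v k - v l) ^+ 2 ->
    1 <= \sum_(p : 'I_n * 'I_n | p.2 == p.1.+1 :> nat) (v p.1 - v p.2) ^+ 2.
  move=> kl t; rewrite (bigD1 (k, l)) //=; apply: le_trans t _.
  by rewrite lerDl; apply: sumr_ge0 => p _; apply: sqr_ge0.
(* Of the two distinct cyclic crossings, at most one uses the wrap-around edge. *)
have [an|an] := eqVneq a.+1 n; last first.
  apply: (one a b); last exact: tab.
  by move: sab; rewrite /= modnS_if // (negbTE an).
apply: (one a' b'); last exact: tab'.
move: sab'; rewrite /= modnS_if //; case: ifP => // /eqP a'n _.
by case/negP: Pa'; rewrite (_ : a' = a) //; exact/val_inj/succn_inj/(etrans a'n (esym an)).
Qed.

Lemma line_energy_const bc n (v : 'I_n -> int) (c : int) :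
  (forall i, v i = c) -> line_energy bc v = 0.
Proof. by move=> vc; apply: big1 => p _; rewrite !vc subrr. Qed.

(** A step function can jump only across the edge leaving t - 1 and, on the cycle, the edge leaving
    n - 1. *)
Lemma line_energy_threshold bc n (v : 'I_n -> int) (c d : int) (t : nat) :
    (c - d) ^+ 2 = 1 -> (forall i, v i = if (i < t)%N then c else d) ->
  line_energy bc v <= (min_flips bc)%:Z.
Proof.
move=> cd vE; pose C := [set p : 'I_n * 'I_n |
  succ_site bc p.1 p.2 && ((p.1 < t) != (p.2 < t))%N].
have -> : line_energy bc v = #|C|%:Z.
  rewrite -sum1_card (big_morph Posz PoszD (erefl _)) /line_energy.
  rewrite [RHS](eq_bigl _ _ (fun p => in_set _ _)) big_mkcondr /=.
  apply: eq_bigr => p _; rewrite !vE.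
  have dc : (d - c) ^+ 2 = 1 by rewrite -sqrrN opprB.
  by do 2![case: ltnP => _ /=]; rewrite ?subrr ?cd ?dc.
rewrite lez_nat cardE.
pose ends := t.-1 :: (if bc is PeriodicBC then [:: n.-1] else [::]).
have -> : min_flips bc = size ends by rewrite /ends; case: (bc).
(* An edge is determined by its tail, so counting the possible tails, listed in [ends], suffices. *)
rewrite -(size_map (fun p : 'I_n * 'I_n => val p.1)); apply: uniq_leq_size.
  rewrite map_inj_in_uniq ?enum_uniq // => -[a b] [a' b'].
  rewrite !mem_enum !inE /= => /andP[s _] /andP[s' _] /val_inj ?; subst a'.
  congr pair; apply: val_inj.
  by move: s s'; case: (bc) => /= /eqP-> /eqP->.
move=> k /mapP[[a b]]; rewrite mem_enum !inE /= => /andP[s ab] ->.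
have la := ltn_ord a; rewrite /ends; move: s.
case: (bc) => /=; rewrite ?inE ?orbF; last by lia.
by rewrite modnS_if //; case: ifP; lia.
Qed.

(** * Sets with few mixed lines *)

Definition mixed (T : finType) (P : pred T) : bool :=
  [exists x, P x] && [exists x, ~~ P x].

Lemma nmixed_eq (T : finType) (P : pred T) (x y : T) : ~~ mixed P -> P x = P y.
Proof.
rewrite negb_and => /orP[] /existsPn nP; have := nP x; have := nP y.
  by move=> /negbTE-> /negbTE->.
by rewrite !negbK => -> ->.
Qed.

(** Each constant line contributes 0 or [#|T|] to the sum. *)
Lemma dvdn_sum_pure (T U : finType) (f : T -> U -> bool) :
    (forall u, ~~ mixed (f^~ u)) ->
  (#|T| %| \sum_t \sum_u f t u)%N.
Proof.
move=> pure; rewrite exchange_big /=; apply: dvdn_sum => u _.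
case: (pickP (f^~ u)) => [t ftu|f0]; last by rewrite big1 // => t _; rewrite f0.
rewrite (eq_bigr (fun=> 1%N)) ?sum1_card // => t' _.
by rewrite (nmixed_eq t' t (pure u)) ftu.
Qed.

Lemma sum_lt_card_exists (T : finType) (P : pred T) :
  (\sum_t P t < #|T|)%N -> exists t, ~~ P t.
Proof.
move=> lt; apply/existsP; apply: contraLR lt => /existsPn nP; rewrite -leqNgt.
rewrite -sum1_card; by apply: leq_sum => t _; have := nP t; rewrite negbK => ->.
Qed.

Lemma sum_nat_le_box (T U : finType) (P : pred T) (Q : pred U) (f : T -> U -> bool) :
    (forall t u, f t u -> P t && Q u) ->
  (\sum_t \sum_u f t u <= (\sum_t P t) * (\sum_u Q u))%N.
Proof.
move=> fPQ; rewrite big_distrl /=; apply: leq_sum => t _.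
rewrite big_distrr /=; apply: leq_sum => u _.
by case: (boolP (f t u)) => // /fPQ/andP[-> ->].
Qed.

Lemma few_mixed_lines (T U : finType) (f : T -> U -> bool) :
    let N := (\sum_t \sum_u f t u)%N in
    (#|T| <= #|U|)%N ->
    (\sum_t mixed (f t) + \sum_u mixed (f^~ u) <= #|T|)%N ->
    (#|T| ^ 2 < 4 * N)%N -> (#|T| ^ 2 < 4 * (#|T| * #|U| - N))%N ->
  (#|T| %| N)%N.
Proof.
move=> N TU.
set r := (\sum_t mixed (f t))%N; set c := (\sum_u mixed (f^~ u))%N.
move=> rc N1 N2.
(* By the AM-GM inequality an r x c box is too small to contain the set or its complement, in view
   of N1 and N2. *)
have rcT : (4 * (r * c) <= #|T| ^ 2)%N.
  by apply: leq_trans (nat_AGM2 r c) _; rewrite leq_sqr.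
(* If every row is mixed, the rows exhaust the budget and all columns are constant. *)
have [r_lt|Tr] := ltnP r #|T|; last first.
  apply: dvdn_sum_pure => u; have : c = 0%N by lia.
  by move/eqP; rewrite sum_nat_eq0 => /forallP/(_ u); rewrite eqb0.
(* If every column is mixed, the budget forces a square with constant rows. *)
have [c_lt|Uc] := ltnP c #|U|; last first.
  have -> : #|T| = #|U| by lia.
  rewrite /N exchange_big; apply: (@dvdn_sum_pure _ _ (fun u t => f t u)) => t.
  have : r = 0%N by lia.
  by move/eqP; rewrite sum_nat_eq0 => /forallP/(_ t); rewrite eqb0.
(* The common value on the crossing of an unmixed row and an unmixed column
   is the value on all unmixed lines. *)
have [t0 pt0] := sum_lt_card_exists r_lt; have [u0 pu0] := sum_lt_card_exists c_lt.
have box t u : f t u != f t0 u0 -> mixed (f t) && mixed (f^~ u).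
  apply: contraNT; rewrite negb_and => /orP[pt|pu].
    by rewrite (nmixed_eq u u0 pt) (nmixed_eq t t0 pu0).
  by rewrite (nmixed_eq t t0 pu) (nmixed_eq u u0 pt0).
have [f0|f0] := boolP (f t0 u0).
  have : (\sum_t \sum_u ~~ f t u <= r * c)%N.
    by apply: sum_nat_le_box => t u ftu; apply: box; rewrite f0 (negbTE ftu).
  have : (\sum_t \sum_u ~~ f t u + N = #|T| * #|U|)%N.
    rewrite -big_split -sum_nat_const; apply: eq_bigr => t _.
    by rewrite -big_split -sum1_card; apply: eq_bigr => u _ /=; case: (f t u).
  by lia.
have : (N <= r * c)%N.
  by apply: sum_nat_le_box => t u ftu; apply: box; rewrite ftu (negbTE f0).
by lia.
Qed.

(** * Lower bound on the communication height *)

Lemma spin_val_inj : injective spin_val.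
Proof. by case; case. Qed.

Lemma energy_ge_mixed bc K L (s : config K L) (a : spin) : (2 < K)%N -> (2 < L)%N ->
  (min_flips bc * (\sum_i mixed (fun j => s (i, j) == a) +
                   \sum_j mixed (fun i => s (i, j) == a)))%N%:Z <= H bc s.
Proof.
move=> K2 L2; rewrite energy_lines // mulnDr PoszD.
have line n (P : 'I_n -> spin) :
    (min_flips bc * mixed (fun i => P i == a))%N%:Z <= line_energy bc (spin_val \o P).
  case: (boolP (mixed _)) => [/andP[/existsP[i /eqP Pi] /existsP[j Pj]]|_].
    rewrite muln1; apply: (@line_energy_ge _ _ _ (spin_val a) i j) => /=.
      by rewrite Pi.
    by rewrite (inj_eq spin_val_inj).
  by rewrite muln0; apply: sumr_ge0 => p _; apply: sqr_ge0.
by rewrite !big_distrr !(big_morph Posz PoszD (erefl _)) lerD //;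
  apply: ler_sum => k _; apply: line.
Qed.

Lemma card_spin_sum K L (s : config K L) (a : spin) :
  #|[set x | s x == a]| = (\sum_i \sum_j (s (i, j) == a))%N.
Proof.
rewrite -sum1_card (eq_bigl _ _ (fun x => in_set _ _)) big_mkcond /=.
by rewrite [RHS]pair_big; apply: eq_bigr => -[i j] _ /=; case: eqP.
Qed.

Lemma one_flip_card K L (s z : config K L) (a : spin) : one_flip s z ->
  (#|[set x | s x == a]| <= #|[set x | z x == a]|.+1)%N.
Proof.
move=> /eqP sz; rewrite -addn1 -{}sz.
apply: leq_trans (leq_card_setU _ _); apply: subset_leq_card; apply/subsetP => x.
by rewrite !inE => /eqP->; case: eqP => //= /eqP; rewrite eq_sym.
Qed.

Lemma one_flip_sym K L : symmetric (@one_flip K L).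
Proof.
by move=> s z; congr (_ == _); apply: eq_card => x; rewrite !inE eq_sym.
Qed.

(** A discrete intermediate value theorem. The [minn] and [maxn] cover both directions, since
    [connects] lets either endpoint come first. *)
Lemma path_intermediate (T : eqType) (e : rel T) (m : T -> nat) (n : nat) (x : T) (w : seq T) :
    (forall y z, e y z -> (m y <= (m z).+1)%N /\ (m z <= (m y).+1)%N) -> path e x w ->
    (minn (m x) (m (last x w)) <= n <= maxn (m x) (m (last x w)))%N ->
  exists2 y, y \in x :: w & m y = n.
Proof.
move=> em; elim: w x => [|y w IHw] x /=.
  by move=> _ ?; exists x; rewrite ?inE ?eqxx //; lia.
case/andP=> /em[xy yx] pw n_bounds; have [xn|xn] := eqVneq (m x) n.
  by exists x => //; rewrite mem_head.
have [|z zw zn] := IHw y pw; first by lia.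
by exists z => //; rewrite in_cons zw orbT.
Qed.

Lemma height_ge bc K L (w0 s : config K L) w : s \in w0 :: w -> H bc s <= height bc w0 w.
Proof.
rewrite /height; elim: w => [|t w IHw]; first by rewrite big_nil inE => /eqP->.
rewrite big_cons !in_cons orbCA le_max => /orP[/eqP->|]; first by rewrite lexx.
by rewrite -in_cons => /IHw->; rewrite orbT.
Qed.

Lemma height_le bc K L (w0 : config K L) w (h : int) :
  H bc w0 <= h -> all (fun s => H bc s <= h) w -> height bc w0 w <= h.
Proof.
rewrite /height => h0; elim: w => [|t w IHw] /=; first by rewrite big_nil.
by case/andP=> ht /IHw hw; rewrite big_cons ge_max ht.
Qed.

Lemma Gamma_min_flips bc K : Gamma bc K = (min_flips bc * K.+1)%N%:Z.
Proof. by case: bc => /=; lia. Qed.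

Lemma Gamma_le_comm_height bc K L (a b : spin) : (5 <= K)%N -> (K <= L)%N -> a != b ->
  Gamma bc K <= comm_height bc K L a b.
Proof.
move=> K5 KL ab; rewrite /comm_height.
have [[w0 [w [[pw ends] ->]]] _] := Phi_minimum bc (mono K L a) (mono K L b).
have card_a : #|[set x | mono K L a x == a]| = (K * L)%N.
  rewrite (_ : [set x | _] = setT) ?cardsT ?card_prod ?card_ord //.
  by apply/setP => x; rewrite !inE ffunE eqxx.
have card_b : #|[set x | mono K L b x == a]| = 0%N.
  by apply/eqP; rewrite cards_eq0; apply/eqP/setP => x; rewrite !inE ffunE eq_sym (negbTE ab).
(* This size is 1 modulo K, and close enough to half of K L that both it and its complement exceed
   K^2 / 4. *)
pose n := (K * L./2).+1.
have L2 : (L = odd L + L./2.*2)%N by rewrite odd_double_half.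
have nKL : (n <= K * L)%N by rewrite /n {2}L2; nia.
have [s sw sn] : exists2 s, s \in w0 :: w & #|[set x | s x == a]| = n.
  apply: (path_intermediate (m := fun s : config K L => #|[set x | s x == a]|) _ pw).
    by move=> y z yz; split; apply: one_flip_card; rewrite // one_flip_sym.
  by case: ends => -[-> ->]; rewrite card_a card_b; lia.
apply: le_trans (height_ge _ sw).
apply: le_trans (energy_ge_mixed bc s a _ _); [|by lia..].
rewrite Gamma_min_flips lez_nat leq_mul2l; apply/orP; right; rewrite ltnNge.
apply/negP => few.
have := @few_mixed_lines 'I_K 'I_L (fun i j => s (i, j) == a).
rewrite !card_ord -card_spin_sum sn KL few => /(_ isT isT).
have sq : (K ^ 2 <= K * L)%N by rewrite -mulnn leq_mul2l KL orbT.
have half : (K * L <= K * L./2 * 2 + K)%N by rewrite {1}L2; nia.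
have half' : (K * L./2 * 2 <= K * L)%N by rewrite {2}L2; nia.
have K25 : (5 * K <= K ^ 2)%N by rewrite -mulnn leq_mul2r K5 orbT.
rewrite /n => div; have {div} := div ltac:(lia) ltac:(lia).
by rewrite -addn1 dvdn_addr ?dvdn_mulr // dvdn1; lia.
Qed.

(** * Upper bound by filling column after column *)

Definition strip_config K L (a b : spin) (n : nat) : config K L :=
  [ffun x : site K L => if (x.2 * K + x.1 < n)%N then b else a].

(** Only column n / K can be mixed, and it is a step function, as is each of the K rows; hence at
    most K + 1 lines have positive energy. *)
Lemma H_strip_le bc K L (a b : spin) (n : nat) : (2 < K)%N -> (2 < L)%N ->
  (spin_val b - spin_val a) ^+ 2 = 1 -> H bc (strip_config K L a b n) <= Gamma bc K.
Proof.
move=> K2 L2 ab; rewrite energy_lines // Gamma_min_flips mulnS PoszD addrC lerD //.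
  have [t_lt|t_ge] := ltnP (n %/ K) L; last first.
    rewrite big1 // => j _; apply: (@line_energy_const _ _ _ (spin_val b)) => i.
    rewrite ffunE /=; case: ltnP => // nji.
    by have := ltn_ord i; have := ltn_ord j; have := leq_divM n K; nia.
  rewrite (bigD1 (Ordinal t_lt)) //= big1 ?addr0 => [|j jt].
    apply: (@line_energy_threshold _ _ _ _ _ ((n %% K)%N) ab) => i.
    by rewrite ffunE /= {2}(divn_eq n K) ltn_add2l; case: ifP.
  apply: (@line_energy_const _ _ _ (spin_val (if (j < n %/ K)%N then b else a))) => i.
  rewrite ffunE /=; congr (spin_val (if _ then b else a)).
  have jn : j != (n %/ K)%N :> nat by [].
  rewrite {1}(divn_eq n K); have := ltn_pmod n (ltnW (ltnW K2)); have := ltn_ord i.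
  move: (n %/ K)%N (n %% K)%N jn => q r jn iK rK.
  case: (ltngtP j q) jn => // jq _.
    by have := leq_mul jq (leqnn K); rewrite mulSn; lia.
  by have := leq_mul jq (leqnn K); rewrite mulSn; lia.
rewrite mulnC -[in X in _ <= X](card_ord K) -sum_nat_const (big_morph Posz PoszD (erefl _)).
apply: ler_sum => i _.
(* The threshold is (n - i) / K rounded up, the number of j with j K + i < n; truncated subtraction
   makes it 0 when n <= i. *)
apply: (@line_energy_threshold _ _ _ _ _ (((n - i + K.-1) %/ K)%N) ab) => j.
rewrite ffunE /=; have -> : (j * K + i < n = (j < (n - i + K.-1) %/ K))%N.
  by rewrite leq_divRL; lia.
by case: ifP.
Qed.

(** The bound covers all configurations after s; in [comm_height_le] the start is monochromatic and
    has energy 0. *)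
Definition low_path bc K L (h : int) (s z : config K L) : Prop :=
  exists w, [/\ path (@one_flip K L) s w, last s w = z & all (fun t => H bc t <= h) w].

Lemma low_path_trans bc K L h (s t z : config K L) :
  low_path bc h s t -> low_path bc h t z -> low_path bc h s z.
Proof.
move=> [w [pw lw aw]] [w' [pw' lw' aw']]; exists (w ++ w').
by rewrite cat_path last_cat all_cat lw pw pw' aw aw'.
Qed.

Lemma low_path_mono bc K L (a b : spin) : (2 < K)%N -> (2 < L)%N ->
    (spin_val b - spin_val a) ^+ 2 = 1 ->
  low_path bc (Gamma bc K) (mono K L a) (mono K L b).
Proof.
move=> K2 L2 ab.
have -> : mono K L a = strip_config K L a b 0 by apply/ffunP => x; rewrite !ffunE.
have -> : mono K L b = strip_config K L a b (K * L).
  apply/ffunP => -[i j]; rewrite !ffunE /= ifT //.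
  by have := ltn_ord i; have := ltn_ord j; nia.
have ne : b != a by apply: contra_eq_neq ab => ->; rewrite subrr.
suff low n : (n <= K * L)%N ->
    low_path bc (Gamma bc K) (strip_config K L a b 0) (strip_config K L a b n).
  exact: low.
elim: n => [|n IHn] nKL; first by exists [::].
apply: low_path_trans (IHn (ltnW nKL)) _.
exists [:: strip_config K L a b n.+1]; split; rewrite //= ?andbT ?H_strip_le //.
have K0 : (0 < K)%N by lia.
have qL : (n %/ K < L)%N by rewrite ltn_divLR // mulnC.
(* The flipped site is the one numbered n, located by Euclidean division by K. *)
rewrite /one_flip (_ : [set _ | _] = [set (Ordinal (ltn_pmod n K0), Ordinal qL)]) ?cards1 //.
apply/setP => -[i j]; rewrite !inE !ffunE /= xpair_eqE -!(inj_eq val_inj) /=.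
transitivity (j * K + i == n)%N.
  by rewrite ltnS; case: (ltngtP (j * K + i)%N n); rewrite ?eqxx // eq_sym ne.
apply/eqP/andP => [<-|[/eqP-> /eqP->]]; last by rewrite -divn_eq.
by rewrite modnMDl divnMDl // modn_small // divn_small // addn0 !eqxx.
Qed.

Lemma comm_height_le bc K L (a b : spin) (h : int) : 0 <= h ->
  low_path bc h (mono K L a) (mono K L b) -> comm_height bc K L a b <= h.
Proof.
move=> h0 [w [pw lw aw]].
have [_ min] := Phi_minimum bc (mono K L a) (mono K L b).
apply: le_trans (min _ _) (height_le (w0 := mono K L a) _ aw).
  by exists (mono K L a), w; split => //; split => //; left.
by rewrite /H big1 // => p _; rewrite !ffunE subrr.
Qed.

Theorem theorem2p3 (bc : boundary) (K L : nat)
    (hK : (5 <= K)%N) (hKL : (K <= L)%N) :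
  comm_height bc K L Minus Zero = Gamma bc K /\
  comm_height bc K L Zero Plus = Gamma bc K /\
  comm_height bc K L Minus Plus = Gamma bc K.
Proof.
have K2 : (2 < K)%N by lia.
have L2 : (2 < L)%N by lia.
have minus_zero : low_path bc (Gamma bc K) (mono K L Minus) (mono K L Zero).
  exact: low_path_mono.
have zero_plus : low_path bc (Gamma bc K) (mono K L Zero) (mono K L Plus).
  exact: low_path_mono.
have Gamma_eq a b : a != b -> low_path bc (Gamma bc K) (mono K L a) (mono K L b) ->
    comm_height bc K L a b = Gamma bc K.
  move=> ab low; apply/le_anti; rewrite Gamma_le_comm_height // andbT.
  by rewrite comm_height_le // Gamma_min_flips.
split; first exact: Gamma_eq.
(* A direct flip from [Minus] to [Plus] has squared difference 4, so the two paths are concatenated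
   at [Zero]. *)
by split; apply: Gamma_eq => //; apply: low_path_trans zero_plus.
Qed.
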